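(* Let $f$ be analytic on the unit disk $\mathbb{D}=\{z\in\mathbb{C}:|z|<1\}$ with $\operatorname{Diam} f(\mathbb{D})\le 2$. Then $|f'(0)|\le 1$. Moreover, $|f'(0)|=1$ if and only if $f(z)=a+cz$ for all $z\in\mathbb{D}$, for some constants $a,c\in\mathbb{C}$ with $|c|=1$.
   Context: For a set $E\subset\mathbb{C}$, $\operatorname{Diam}E=\sup_{z,w\in E}|z-w|$. *)

(* Defs.v *)
From mathcomp Require Import all_boot all_order all_algebra.
From mathcomp Require Import all_classical all_reals all_analysis.
From mathcomp Require Import complex.
Import Order.TTheory GRing.Theory Num.Theory.
Import numFieldNormedType.Exports.
Set Implicit Arguments.
Unset Strict Implicit.
Unset Printing Implicit Defensive.
Local Open Scope ring_scope.
Local Open Scope classical_set_scope.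

(* The complex plane, viewed as a normed module over itself (regular algebra),
   so that [derivable f z 1] is complex differentiability. *)
Definition Cplx (R : realType) := (R[i])^o.

Definition unit_disk (R : realType) : set (Cplx R) := [set z | `|z| < 1].
Arguments unit_disk R : clear implicits.

Definition analytic_on_disk (R : realType) (f : Cplx R -> Cplx R) : Prop :=
  forall z : Cplx R, z \in unit_disk R -> derivable f z 1.

Definition Diam_le (R : realType) (E : set (Cplx R)) (d : Cplx R) : Prop :=
  forall z w, E z -> E w -> `|z - w| <= d.

(* Main.v *)
Require Import Defs.
From mathcomp Require Import all_boot all_order all_algebra.
From mathcomp Require Import all_classical all_reals all_analysis.
From mathcomp Require Import complex ring lra.
Import Order.TTheory GRing.Theory Num.Theory.
Import numFieldNormedType.Exports.
Import ComplexField.Normc.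
Set Implicit Arguments.
Unset Strict Implicit.
Unset Printing Implicit Defensive.
Local Open Scope ring_scope.
Local Open Scope classical_set_scope.

(** Applied to [z |-> f z - f (w * z)] with [|w| <= 1], Schwarz's lemma gives
    [|f z - f u| <= 2 |z|] whenever [|u| <= |z|].  For [w = -1] it also gives
    [|f'(0)| <= 1] and, when [c = f'(0)] has modulus [1], [f z - f (- z) = 2 c z].
    Then [u |-> Re (conj (c z) (f u - f (- z)))] is maximal at [u = z] on the circle
    [|u| = |z|], so its derivative along the circle vanishes there: [conj c * f' z]
    is real.  A holomorphic function with real derivative has constant derivative.

    The maximum principle behind Schwarz's lemma comes from the mean value property.
    As [f (z0 + b exp z)] has period [2 pi i], Goursat's theorem on rectangles shows
    that the means of [f] over circles centred at [z0] do not depend on the radius.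
    At [z0] itself only continuity of [f] is needed, so the quotient [g z / z] of
    Schwarz's lemma is covered without removing its singularity. *)

Local Notation Re := (@complex.Re _).
Local Notation Im := (@complex.Im _).

(** * The complex plane *)

Section ComplexPlane.
Variable R : realType.
Local Notation C := (Cplx R).
Implicit Types z w : C.

Lemma ReD z w : Re (z + w) = Re z + Re w. Proof. by case: z; case: w. Qed.
Lemma ReN z : Re (- z) = - Re z. Proof. by case: z. Qed.
Lemma ReB z w : Re (z - w) = Re z - Re w. Proof. by case: z; case: w. Qed.
Lemma ImB z w : Im (z - w) = Im z - Im w. Proof. by case: z; case: w. Qed.

Lemma eq_ReIm z w : Re z = Re w -> Im z = Im w -> z = w.
Proof. by case: z => a b; case: w => c d /= -> ->. Qed.

Lemma norm_normc z : `|z| = (normc z)%:C%C. Proof. by []. Qed.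

Lemma normc_ge0 z : 0 <= normc z. Proof. by case: z => x y; exact: sqrtr_ge0. Qed.

Lemma normc_eq0 z : (normc z == 0) = (z == 0).
Proof. by rewrite -(inj_eq (@complexI R)) -norm_normc normr_eq0. Qed.

Lemma normc_gt0 z : (0 < normc z) = (z != 0).
Proof. by rewrite lt_def normc_eq0 normc_ge0 andbT. Qed.

Lemma normc_sqr z : normc z ^+ 2 = Re z ^+ 2 + Im z ^+ 2.
Proof. by case: z => x y; rewrite sqr_sqrtr// addr_ge0// sqr_ge0. Qed.

Lemma normcBC z w : normc (z - w) = normc (w - z).
Proof. by rewrite -opprB normcN. Qed.

Lemma normc_conj z : normc (z^*)%C = normc z.
Proof. by case: z => x y /=; rewrite sqrrN. Qed.

Lemma normcR (x : R) : normc x%:C%C = `|x|.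
Proof. by rewrite /= expr0n/= addr0 sqrtr_sqr. Qed.

Lemma normc_nat n : normc (n%:R : C) = n%:R.
Proof. by rewrite normcMn normc1. Qed.

Lemma mulJc z : (z^*)%C * z = (normc z ^+ 2)%:C%C.
Proof. by rewrite mulrC -sqr_normc norm_normc rmorphXn. Qed.

Lemma normcD_sqr z w :
  normc (z + w) ^+ 2 = normc z ^+ 2 + 2 * Re ((z^*)%C * w) + normc w ^+ 2.
Proof. by rewrite !normc_sqr; case: z => a b; case: w => c d /=; ring. Qed.

Lemma Re_le_normc z : `|Re z| <= normc z.
Proof. by rewrite -lecR -norm_normc normc_ge_Re. Qed.

Lemma Im_le_normc z : `|Im z| <= normc z.
Proof.
rewrite -(@ler_pXn2r _ 2)// ?nnegrE ?normc_ge0//.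
by rewrite normc_sqr real_normK ?num_real// lerDr sqr_ge0.
Qed.

Lemma normc_le_ReIm z : normc z <= `|Re z| + `|Im z|.
Proof.
rewrite {1}[z]complexE (le_trans (le_normcD _ _))// normcM !normcR.
by rewrite lerD2l /= expr0n/= expr1n add0r sqrtr1 mul1r.
Qed.

Lemma mem_unit_disk z : (z \in unit_disk R) = (normc z < 1).
Proof. by apply/idP/idP; rewrite inE /unit_disk/= norm_normc ltcR. Qed.

Lemma cvg_normcP (T : Type) (F : set_system T) (f : T -> C) (l : C) :
  Filter F ->
  f @ F --> l <-> forall e, 0 < e -> \forall x \near F, normc (f x - l) < e.
Proof.
move=> FF; split=> [/cvgrPdistC_lt fl e e0|fl].
  have := fl e%:C%C; rewrite ltcR => /(_ e0).
  by apply: filterS => x; rewrite norm_normc ltcR.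
apply/cvgrPdistC_lt => e; rewrite ltcE => /andP[/eqP /= e_real e_gt0].
apply: filterS (fl _ e_gt0) => x; rewrite norm_normc => fxl.
by rewrite ltcE /= e_real eqxx.
Qed.

Lemma continuous_normcP (T : topologicalType) (f : T -> C) t :
  {for t, continuous f} <->
  forall e, 0 < e -> \forall x \near t, normc (f x - f t) < e.
Proof. exact: (cvg_normcP _ _ (nbhs_filter t)). Qed.

Lemma near_normc z (e : R) : 0 < e -> \forall w \near z, normc (w - z) < e.
Proof. by have /cvg_normcP/(_ e) := @cvg_id _ (nbhs z); apply. Qed.

Lemma nbhs_normcP z (P : set C) :
  nbhs z P <-> exists2 d, 0 < d & forall w, normc (w - z) < d -> P w.
Proof.
split=> [/nbhs_ballP[d /= d0 dP]|[d d0 dP]]; last first.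
  by have := near_normc z d0; apply: filterS.
move: d0; rewrite ltcE => /andP[/eqP /= d_real d_gt0].
exists (Re d) => // w zw; apply: dP.
by rewrite -ball_normE/= norm_normc ltcE /= d_real eqxx normcBC.
Qed.

Lemma continuous_Re : continuous (Re : C -> R).
Proof.
move=> z; apply/(@cvgrPdistC_lt _ _ _ _ (nbhs_filter z)) => e e0.
apply/nbhs_normcP; exists e => // w.
by rewrite -ReB; exact/le_lt_trans/Re_le_normc.
Qed.

Lemma continuous_Im : continuous (Im : C -> R).
Proof.
move=> z; apply/(@cvgrPdistC_lt _ _ _ _ (nbhs_filter z)) => e e0.
apply/nbhs_normcP; exists e => // w.
by rewrite -ImB; exact/le_lt_trans/Im_le_normc.
Qed.

Lemma continuous_Complex (T : topologicalType) (a b : T -> R) t :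
  {for t, continuous a} -> {for t, continuous b} ->
  {for t, continuous (fun s => (a s +i* b s)%C : C)}.
Proof.
move=> /cvgrPdistC_lt ca /cvgrPdistC_lt cb; apply/continuous_normcP => e e0.
have e2 : 0 < e / 2 by rewrite divr_gt0.
apply: filterS2 (ca _ e2) (cb _ e2) => s sa sb.
by rewrite [e]splitr; apply: le_lt_trans (normc_le_ReIm _) _; exact: ltrD.
Qed.

End ComplexPlane.

Lemma le0_of_le_epsM (R : realFieldType) (x k : R) :
  (forall e, 0 < e -> x <= e * k) -> x <= 0.
Proof.
move=> xek; apply/ler_addgt0Pr => e e0; rewrite add0r.
have k0 : 0 < `|k| + 1 by rewrite ltr_pwDr.
apply: le_trans (xek _ (divr_gt0 e0 k0)) _; rewrite mulrAC ler_pdivrMr//.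
by rewrite ler_pM2l// (le_trans (ler_norm k))// lerDl.
Qed.

(** * Complex differentiation *)

Section Slope.
Variable K : numFieldType.
Implicit Types (f g : K^o -> K^o) (z w a b : K^o).

Definition slope f z w : K^o := if w == z then 'D_1 f z else (f w - f z) / (w - z).

Lemma slope_diag f z : slope f z z = 'D_1 f z. Proof. by rewrite /slope eqxx. Qed.

Lemma slopeM f z w : slope f z w * (w - z) = f w - f z.
Proof.
rewrite /slope; case: eqVneq => [->|wz]; first by rewrite !subrr mulr0.
by rewrite divfK// subr_eq0.
Qed.

Lemma derivable_continuous f z : derivable f z 1 -> {for z, continuous f}.
Proof. by move=> /derivable1_diffP; exact: differentiable_continuous. Qed.

Lemma derivable_slope f z w : w != z -> derivable f w 1 -> derivable (slope f z) w 1.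
Proof.
move=> wz df.
have dg : derivable (fun x : K^o => (f x - f z) * (x - z)^-1 : K^o) w 1.
  apply: derivableM; first exact: derivableB.
  by apply: derivableV; [rewrite subr_eq0|exact: derivableB].
apply: near_eq_derivable dg; near=> x; rewrite /slope ifN// -subr_eq0.
near: x; apply: (cvgr_neq0 (w - z)); last by rewrite subr_eq0.
by apply: cvgB; [exact: cvg_id|exact: cvg_cst].
Unshelve. all: by end_near. Qed.

Lemma continuous_slope f z : derivable f z 1 -> {for z, continuous (slope f z)}.
Proof.
move=> df; apply/continuous_withinNshiftx; rewrite slope_diag.
apply: cvg_trans df; apply: near_eq_cvg; near=> h.
have h0 : h != 0 by near: h; exact: nbhs_dnbhs_neq.
rewrite /slope /= -[_%:A]/(h * 1) mulr1 ifN; last by rewrite -subr_eq0 addrK.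
by rewrite addrK mulrC.
Unshelve. all: by end_near. Qed.

Lemma is_derive_of_slope f g z : (forall w, f w - f z = g w * (w - z)) ->
  {for z, continuous g} -> is_derive z 1 f (g z).
Proof.
move=> fg /continuous_withinNshiftx cg.
suff lim_g : h^-1 *: (f (h *: 1 + z) - f z) @[h --> 0^'] --> g z.
  by split; [apply/cvg_ex; exists (g z)|apply: cvg_lim].
apply: cvg_trans cg; apply: near_eq_cvg; near=> h.
have h0 : h != 0 by near: h; exact: nbhs_dnbhs_neq.
by rewrite /= fg -[_%:A]/(h * 1) mulr1 addrK -[RHS]/(h^-1 * _) mulrCA mulVf ?mulr1.
Unshelve. all: by end_near. Qed.

Lemma is_derive_affine a b z : is_derive z 1 (fun w : K^o => a + b * w : K^o) b.
Proof.
apply: (is_derive_of_slope (g := cst b)) => [w|]; last exact: cst_continuous.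
by rewrite opprD addrACA subrr add0r mulrBr.
Qed.

Lemma continuous_affine a b : continuous (fun w : K^o => a + b * w : K^o).
Proof.
by move=> z; have [affine_diff _] := is_derive_affine a b z; exact: derivable_continuous.
Qed.

Lemma is_derive_mull b z : is_derive z 1 ( *%R b : K^o -> K^o) b.
Proof.
apply: (is_derive_of_slope (g := cst b)) => [w|]; last exact: cst_continuous.
by rewrite mulrBr.
Qed.

Lemma is_derive_comp f g z a b : is_derive (g z) 1 f a -> is_derive z 1 g b ->
  is_derive z 1 (f \o g) (a * b).
Proof.
move=> [df <-] [dg <-]; rewrite -!slope_diag.
apply: (is_derive_of_slope (g := fun w => slope f (g z) (g w) * slope g z w)) => [w|].
  by rewrite -mulrA !slopeM.
apply: continuousM; last exact: continuous_slope.
apply: (continuous_comp (f := g)); last exact: continuous_slope.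
exact: derivable_continuous.
Qed.

End Slope.

Lemma is_derive_normc_le (R : realType) (f : Cplx R -> Cplx R) (z a : Cplx R) :
  (forall e, 0 < e ->
    \forall w \near z, normc (f w - f z - a * (w - z)) <= e * normc (w - z)) ->
  is_derive z 1 f a.
Proof.
move=> fa; pose g w : Cplx R := if w == z then a else (f w - f z) / (w - z).
have -> : a = g z by rewrite /g eqxx.
apply: is_derive_of_slope => [w|].
  rewrite /g; case: eqVneq => [->|wz]; first by rewrite !subrr mulr0.
  by rewrite divfK// subr_eq0.
apply/continuous_normcP => e e0; have e2 : 0 < e / 2 by rewrite divr_gt0.
apply: filterS (fa _ e2) => w; rewrite /g eqxx; case: eqVneq => [_|wz].
  by rewrite subrr normc0.
have wz0 : 0 < normc (w - z) by rewrite normc_gt0 subr_eq0.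
rewrite -(ltr_pM2r wz0) -normcM mulrBl divfK ?subr_eq0//.
by move=> /le_lt_trans; apply; rewrite ltr_pM2r//; lra.
Qed.

(** * Integrals over segments *)

Section SegmentIntegral.
Variable R : realType.
Local Notation mu := (@lebesgue_measure R).
Implicit Types (p : R -> R) (a b k t : R).

Lemma integrable_segment p a b : {within `[a, b], continuous p} ->
  mu.-integrable `[a, b] (EFin \o p).
Proof. exact/continuous_compact_integrable/segment_compact. Qed.

Lemma Rintegral_segment_cst a b k : a <= b ->
  \int[mu]_(t in `[a, b]) k = k * (b - a).
Proof.
move=> ab; rewrite Rintegral_cst//= lebesgue_measure_itv/= lte_fin.
by case: ltgtP ab => // -> _; rewrite subrr.
Qed.

Lemma Rintegral_segment_le p a b k : a <= b -> {within `[a, b], continuous p} ->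
  (forall t, a <= t <= b -> p t <= k) -> \int[mu]_(t in `[a, b]) p t <= k * (b - a).
Proof.
move=> ab pc pk; rewrite -Rintegral_segment_cst//.
apply: le_Rintegral => //; first exact: integrable_segment.
by apply/integrable_segment/continuous_subspaceT => t; exact: cst_continuous.
Qed.

Lemma Rintegral_segment_ge p a b k : a <= b -> {within `[a, b], continuous p} ->
  (forall t, a <= t <= b -> k <= p t) -> k * (b - a) <= \int[mu]_(t in `[a, b]) p t.
Proof.
move=> ab pc pk; rewrite -Rintegral_segment_cst//.
apply: le_Rintegral => //; last exact: integrable_segment.
by apply/integrable_segment/continuous_subspaceT => t; exact: cst_continuous.
Qed.

Lemma Rintegral_segment_close p a b k m : a <= b -> {within `[a, b], continuous p} ->
  (forall t, a <= t <= b -> `|p t - k| <= m) ->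
  `|\int[mu]_(t in `[a, b]) p t - k * (b - a)| <= m * (b - a).
Proof.
move=> ab pc pk; rewrite ler_distl -mulrBl -mulrDl.
apply/andP; split.
  by apply: Rintegral_segment_ge => // t /pk; rewrite ler_distl => /andP[].
by apply: Rintegral_segment_le => // t /pk; rewrite ler_distl => /andP[].
Qed.

Lemma Rintegral_segmentD p a b x : a <= x <= b -> {within `[a, b], continuous p} ->
  \int[mu]_(t in `[a, b]) p t = \int[mu]_(t in `[a, x]) p t + \int[mu]_(t in `[x, b]) p t.
Proof.
move=> /andP[ax xb] /integrable_segment ip.
rewrite -(@Rintegral_itv_obnd_cbnd _ x (BRight b)); last first.
  by apply: integrableS ip => //; apply: subset_itvr; rewrite bnd_simp.
by rewrite -(@Rintegral_itvB _ p (BLeft a) (BRight b)) ?bnd_simp// addrC subrK.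
Qed.

Lemma Rintegral_segment_eq0 p a b x : {within `[a, b], continuous p} ->
  (forall t, a <= t <= b -> 0 <= p t) -> \int[mu]_(t in `[a, b]) p t = 0 ->
  a < x < b -> {for x, continuous p} -> p x = 0.
Proof.
move=> pc p0 I0 /andP[ax xb] px.
have F0 y : a < y < b -> \int[mu]_(t in `[a, y]) p t = 0.
  move=> yab; apply/eqP; rewrite eq_le Rintegral_ge0 ?andbT; last first.
    by move=> t /=; rewrite in_itv/= => tay; apply: p0; lra.
  rewrite -I0 (@Rintegral_segmentD _ _ _ y)//; last lra.
  by rewrite lerDl Rintegral_ge0// => t /=; rewrite in_itv/= => tyb; apply: p0; lra.
have [_ <-] := continuous_FTC1_closed xb (integrable_segment pc) ax px.
rewrite derive1E (@near_eq_derive _ _ _ _ (cst 0)) ?derive_cst//.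
near=> y; rewrite F0//; apply/andP; split; near: y.
  exact: lt_nbhsr.
exact: lt_nbhsl.
Unshelve. all: by end_near. Qed.

End SegmentIntegral.

(** * Bisection of rectangles *)

Section Bisection.
Variable R : realType.
Local Notation C := (Cplx R).
Implicit Types (I J : R * R) (z : C).

Definition seg_length I : R := I.2 - I.1.

Definition half_seg (upper : bool) I : R * R :=
  let m := (I.1 + I.2) / 2 in if upper then (m, I.2) else (I.1, m).

Definition rectangle I J : set C := [set z | I.1 <= Re z <= I.2 /\ J.1 <= Im z <= J.2].

Lemma half_seg_proper upper I : I.1 <= I.2 -> (half_seg upper I).1 <= (half_seg upper I).2.
Proof. by case: upper; rewrite /=; lra. Qed.

Lemma seg_length_half upper I : seg_length (half_seg upper I) = seg_length I / 2.
Proof. by rewrite /seg_length; case: upper => /=; lra. Qed.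

Lemma sub_half_rectangle b c I J : I.1 <= I.2 -> J.1 <= J.2 ->
  rectangle (half_seg b I) (half_seg c J) `<=` rectangle I J.
Proof. by move=> ? ? z []; case: b; case: c => /= ? ?; split; lra. Qed.

Lemma nested_half_segs (u : nat -> R * R) : (u 0%N).1 <= (u 0%N).2 ->
  (forall n, exists upper, u n.+1 = half_seg upper (u n)) ->
  exists x, forall n, (u n).1 <= x <= (u n).2.
Proof.
move=> u0 uS.
have proper n : (u n).1 <= (u n).2.
  by elim: n => // n IH; have [b ->] := uS n; exact: half_seg_proper.
have inc : nondecreasing_seq (fst \o u).
  by apply/nondecreasing_seqP => n; have [[] /= ->] := uS n; have /= := proper n; lra.
have dec : nonincreasing_seq (snd \o u).
  by apply/nonincreasing_seqP => n; have [[] /= ->] := uS n; have /= := proper n; lra.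
have lower_le_upper m n : (u m).1 <= (u n).2.
  apply: (@le_trans _ _ (u (maxn m n)).1); first exact/inc/leq_maxl.
  by apply: le_trans (proper _) _; exact/dec/leq_maxr.
exists (sup (range (fst \o u))) => n; apply/andP; split.
  by apply: ub_le_sup; [exists (u 0%N).2 => _ [m _ <-]; exact: lower_le_upper|exists n].
by apply: ge_sup => [|_ [m _ <-]]; [exists (u 0%N).1, 0%N|exact: lower_le_upper].
Qed.

Lemma seg_length_iter_half (u : nat -> R * R) :
  (forall n, exists upper, u n.+1 = half_seg upper (u n)) ->
  forall n, seg_length (u n) = seg_length (u 0%N) / 2 ^+ n.
Proof.
move=> uS; elim=> [|n IH]; first by rewrite divr1.
by have [b ->] := uS n; rewrite seg_length_half IH exprSr invfM mulrA.
Qed.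

Lemma near_div_expr2_lt (x d : R) : 0 < d -> \forall n \near \oo, x / 2 ^+ n < d.
Proof.
move=> d0.
have lim0 : x / 2 ^+ n @[n --> \oo] --> (0 : R).
  under eq_fun do rewrite -exprVn; apply: cvg_geometric.
  by rewrite gtr0_norm ?invf_lt1 ?ltr1n.
exact: cvgr_lt lim0 _ d0.
Qed.

Theorem rectangle_bisection (P : R * R -> R * R -> Prop) I J :
  I.1 <= I.2 -> J.1 <= J.2 ->
  (forall I' J', (forall b c, P (half_seg b I') (half_seg c J')) -> P I' J') ->
  (forall z, rectangle I J z -> exists2 d, 0 < d & forall I' J',
     rectangle I' J' z -> seg_length I' < d -> seg_length J' < d -> P I' J') ->
  P I J.
Proof.
move=> I12 J12 Psplit Plocal; apply: contrapT => nPIJ.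
pose next (s t : (R * R) * (R * R)) := ~ P s.1 s.2 ->
  ~ P t.1 t.2 /\ exists b c, t = (half_seg b s.1, half_seg c s.2).
have next_total s : {t | next s t}.
  apply: cid; have [Ps|nPs] := pselect (P s.1 s.2); first by exists s.
  have [[b c] nP] : exists bc, ~ P (half_seg bc.1 s.1) (half_seg bc.2 s.2).
    apply: contrapT => /forallNP allP; apply/nPs/Psplit => b c.
    exact: contrapT (allP (b, c)).
  by exists (half_seg b s.1, half_seg c s.2) => _; split => //; exists b, c.
have [u [u0 uS]] := dependent_choice next_total (I, J).
have nPu n : ~ P (u n).1 (u n).2.
  by elim: n => [|n IH]; [rewrite u0|have [] := uS n IH].
have halfx n : exists b, (u n.+1).1 = half_seg b (u n).1.
  by have [_ [b [c ->]]] := uS n (nPu n); exists b.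
have halfy n : exists c, (u n.+1).2 = half_seg c (u n).2.
  by have [_ [b [c ->]]] := uS n (nPu n); exists c.
have [|x xu] := @nested_half_segs (fst \o u) _ halfx; first by rewrite /= u0.
have [|y yu] := @nested_half_segs (snd \o u) _ halfy; first by rewrite /= u0.
have [|d d0 Pd] := Plocal (x +i* y)%C.
  by have := conj (xu 0%N) (yu 0%N); rewrite /= u0.
have [n [In Jn]] : exists n, seg_length (u n).1 < d /\ seg_length (u n).2 < d.
  near \oo => n; exists n; split.
    rewrite (seg_length_iter_half (u := fst \o u) halfx).
    by near: n; exact: near_div_expr2_lt.
  rewrite (seg_length_iter_half (u := snd \o u) halfy).
  by near: n; exact: near_div_expr2_lt.
by apply: (nPu n); apply: Pd => //; split; [exact: xu|exact: yu].
Unshelve. all: by end_near. Qed.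

End Bisection.

(** * Goursat's theorem *)

Section Goursat.
Variable R : realType.
Local Notation C := (Cplx R).
Local Notation mu := (@lebesgue_measure R).
Implicit Types (f : C -> C) (I J : R * R) (z : C).

(* The imaginary part of the integral of [f] along the boundary of [rectangle I J],
   traversed counterclockwise. *)
Definition Im_contour_integral f I J : R :=
  \int[mu]_(t in `[J.1, J.2]) Re (f (I.2 +i* t)%C)
  - \int[mu]_(t in `[J.1, J.2]) Re (f (I.1 +i* t)%C)
  + \int[mu]_(s in `[I.1, I.2]) Im (f (s +i* J.1)%C)
  - \int[mu]_(s in `[I.1, I.2]) Im (f (s +i* J.2)%C).

Lemma continuous_Re_vertical f I J x :
  (forall z, rectangle I J z -> {for z, continuous f}) -> I.1 <= x <= I.2 ->
  {within `[J.1, J.2], continuous (fun t => Re (f (x +i* t)%C))}.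
Proof.
move=> fc xI; apply: continuous_in_subspaceT => t; rewrite inE/= in_itv/= => tJ.
apply: (continuous_comp (f := fun t => f (x +i* t)%C)); last exact: continuous_Re.
apply: (continuous_comp (f := fun t => (x +i* t)%C : C)); last by apply: fc; split.
exact/continuous_Complex/cvg_id/cst_continuous.
Qed.

Lemma continuous_Im_horizontal f I J y :
  (forall z, rectangle I J z -> {for z, continuous f}) -> J.1 <= y <= J.2 ->
  {within `[I.1, I.2], continuous (fun s => Im (f (s +i* y)%C))}.
Proof.
move=> fc yJ; apply: continuous_in_subspaceT => s; rewrite inE/= in_itv/= => sI.
apply: (continuous_comp (f := fun s => f (s +i* y)%C)); last exact: continuous_Im.
apply: (continuous_comp (f := fun s => (s +i* y)%C : C)); last by apply: fc; split.
exact/continuous_Complex/cst_continuous/cvg_id.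
Qed.

Lemma Im_contour_integral_split_Re f I J x :
  (forall z, rectangle I J z -> {for z, continuous f}) ->
  J.1 <= J.2 -> I.1 <= x <= I.2 ->
  Im_contour_integral f I J =
  Im_contour_integral f (I.1, x) J + Im_contour_integral f (x, I.2) J.
Proof.
move=> fc J12 xI; rewrite /Im_contour_integral /=.
rewrite !(@Rintegral_segmentD _ (fun s => Im _) _ _ _ xI); first ring.
all: by apply: (continuous_Im_horizontal fc); lra.
Qed.

Lemma Im_contour_integral_split_Im f I J y :
  (forall z, rectangle I J z -> {for z, continuous f}) ->
  I.1 <= I.2 -> J.1 <= y <= J.2 ->
  Im_contour_integral f I J =
  Im_contour_integral f I (J.1, y) + Im_contour_integral f I (y, J.2).
Proof.
move=> fc I12 yJ; rewrite /Im_contour_integral /=.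
rewrite !(@Rintegral_segmentD _ (fun t => Re _) _ _ _ yJ); first ring.
all: by apply: (continuous_Re_vertical fc); lra.
Qed.

Lemma Im_contour_integral_quarters f I J :
  (forall z, rectangle I J z -> {for z, continuous f}) -> I.1 <= I.2 -> J.1 <= J.2 ->
  Im_contour_integral f I J = \sum_(b : bool) \sum_(c : bool)
    Im_contour_integral f (half_seg b I) (half_seg c J).
Proof.
move=> fc I12 J12.
have fc_half b z : rectangle (half_seg b I) J z -> {for z, continuous f}.
  by move=> [zI zJ]; apply: fc; split => //; move: zI; case: b => /=; lra.
rewrite (@Im_contour_integral_split_Re _ _ _ ((I.1 + I.2) / 2))//; last lra.
rewrite (@Im_contour_integral_split_Im _ (_, I.2) _ ((J.1 + J.2) / 2)) /=; try lra.
  rewrite (@Im_contour_integral_split_Im _ (I.1, _) _ ((J.1 + J.2) / 2)) /=; try lra.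
    by rewrite !big_bool/=; ring.
  exact: (fc_half false).
exact: (fc_half true).
Qed.

Lemma Im_contour_integral_near_affine f I J (a k : C) m :
  (forall z, rectangle I J z -> {for z, continuous f}) -> I.1 <= I.2 -> J.1 <= J.2 ->
  (forall z, rectangle I J z -> normc (f z - (k + a * z)) <= m) ->
  `|Im_contour_integral f I J| <= 2 * m * (seg_length I + seg_length J).
Proof.
move=> fc I12 J12 fm.
have increment z w : rectangle I J z -> rectangle I J w ->
    normc (f z - f w - a * (z - w)) <= 2 * m.
  move=> /fm zm /fm wm.
  have -> : f z - f w - a * (z - w) = f z - (k + a * z) - (f w - (k + a * w)) by ring.
  by rewrite (le_trans (le_normcD _ _))// normcN; lra.
have vertical : `|\int[mu]_(t in `[J.1, J.2]) Re (f (I.2 +i* t)%C)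
    - \int[mu]_(t in `[J.1, J.2]) Re (f (I.1 +i* t)%C)
    - Re a * seg_length I * seg_length J| <= 2 * m * seg_length J.
  have left_cont := @continuous_Re_vertical f I J I.1 fc.
  have right_cont := @continuous_Re_vertical f I J I.2 fc.
  rewrite -RintegralB//; last 2 first.
  - by apply: integrable_segment; apply: right_cont; lra.
  - by apply: integrable_segment; apply: left_cont; lra.
  apply: Rintegral_segment_close => // [|t tJ].
    by move=> t; apply: cvgB; [apply: right_cont|apply: left_cont]; lra.
  have -> : Re a * seg_length I = Re (a * ((I.2 +i* t)%C - (I.1 +i* t)%C)).
    by case: (a) => b c /=; rewrite /seg_length; ring.
  rewrite -!ReB; apply: le_trans (Re_le_normc _) (increment _ _ _ _); split => /=; lra.
have horizontal : `|\int[mu]_(s in `[I.1, I.2]) Im (f (s +i* J.1)%C)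
    - \int[mu]_(s in `[I.1, I.2]) Im (f (s +i* J.2)%C)
    - - Re a * seg_length J * seg_length I| <= 2 * m * seg_length I.
  have lower_cont := @continuous_Im_horizontal f I J J.1 fc.
  have upper_cont := @continuous_Im_horizontal f I J J.2 fc.
  rewrite -RintegralB//; last 2 first.
  - by apply: integrable_segment; apply: lower_cont; lra.
  - by apply: integrable_segment; apply: upper_cont; lra.
  apply: Rintegral_segment_close => // [|s sI].
    by move=> s; apply: cvgB; [apply: lower_cont|apply: upper_cont]; lra.
  have -> : - Re a * seg_length J = Im (a * ((s +i* J.1)%C - (s +i* J.2)%C)).
    by case: (a) => b c /=; rewrite /seg_length; ring.
  rewrite -!ImB; apply: le_trans (Im_le_normc _) (increment _ _ _ _); split => /=; lra.
move: vertical horizontal; rewrite /Im_contour_integral !ler_norml; lra.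
Qed.

Theorem goursat f I J : I.1 <= I.2 -> J.1 <= J.2 ->
  (forall z, rectangle I J z -> derivable f z 1) -> Im_contour_integral f I J = 0.
Proof.
move=> I12 J12 df.
have fc z : rectangle I J z -> {for z, continuous f}.
  by move=> /df; exact: derivable_continuous.
pose sqr_size (I J : R * R) := 4 * (seg_length I ^+ 2 + seg_length J ^+ 2).
apply/normr0_eq0/eqP; rewrite eq_le normr_ge0 andbT.
apply: (@le0_of_le_epsM _ _ (sqr_size I J)) => e e0.
pose P I' J' := I'.1 <= I'.2 -> J'.1 <= J'.2 -> rectangle I' J' `<=` rectangle I J ->
  `|Im_contour_integral f I' J'| <= e * sqr_size I' J'.
suff : P I J by apply.
apply: rectangle_bisection => // [I' J' Phalf I'12 J'12 sub|z /df dfz].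
  rewrite Im_contour_integral_quarters//; last by move=> z /sub/fc.
  have -> : e * sqr_size I' J' =
      \sum_(b : bool) \sum_(c : bool) e * sqr_size (half_seg b I') (half_seg c J').
    by rewrite !big_bool /sqr_size !seg_length_half /=; field.
  apply: le_trans (ler_norm_sum _ _ _) _; apply: ler_sum => b _.
  apply: le_trans (ler_norm_sum _ _ _) _; apply: ler_sum => c _.
  apply: Phalf; [exact: half_seg_proper|exact: half_seg_proper|].
  exact: subset_trans (sub_half_rectangle I'12 J'12) sub.
have /continuous_normcP/(_ e e0)/nbhs_normcP[d d0 dP] := continuous_slope dfz.
exists (d / 2); first by rewrite divr_gt0.
move=> I' J' [zI zJ] I'd J'd I'12 J'12 sub; set l := seg_length I' + seg_length J'.
have close w : rectangle I' J' w ->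
    normc (f w - (f z - 'D_1 f z * z + 'D_1 f z * w)) <= e * l.
  move=> [wI wJ]; have wz : normc (w - z) <= l.
    apply: le_trans (normc_le_ReIm _) _.
    by rewrite ReB ImB lerD// ler_norml /seg_length; lra.
  have -> : f w - (f z - 'D_1 f z * z + 'D_1 f z * w) =
      (slope f z w - slope f z z) * (w - z).
    by rewrite mulrBl slopeM slope_diag; ring.
  rewrite normcM ler_pM ?normc_ge0// ltW// dP//.
  by apply: le_lt_trans wz _; rewrite /l; lra.
have fc' w : rectangle I' J' w -> {for w, continuous f} by move=> /sub/fc.
apply: le_trans (Im_contour_integral_near_affine fc' I'12 J'12 close) _.
have -> : 2 * (e * l) * l = e * (2 * l ^+ 2) by ring.
rewrite ler_pM2l// /sqr_size /l.
have := sqr_ge0 (seg_length I' - seg_length J'); lra.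
Qed.

End Goursat.

(** * The complex exponential *)

Section ComplexExponential.
Variable R : realType.
Local Notation C := (Cplx R).
Implicit Types (f : C -> C) (z w : C).

Definition cexp z : C := (expR (Re z) * cos (Im z) +i* (expR (Re z) * sin (Im z)))%C.

Lemma cexp0 : cexp 0 = 1.
Proof. by rewrite /cexp expR0 cos0 sin0 mulr0 mulr1. Qed.

Lemma cexpD z w : cexp (z + w) = cexp z * cexp w.
Proof.
case: z w => [x y] [u v]; rewrite /cexp /= expRD cosD sinD.
by apply: eq_ReIm => /=; ring.
Qed.

Lemma cexp_periodic (x y : R) : cexp (x +i* (y + 2 * pi))%C = cexp (x +i* y)%C.
Proof. by rewrite /cexp /= mulr_natl cosD2pi sinD2pi. Qed.

Lemma cexp_pi : cexp (0 +i* pi)%C = -1.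
Proof.
by apply: eq_ReIm; rewrite /= expR0 ?cospi ?sinpi mul1r// oppr0.
Qed.

Lemma normc_cexp z : normc (cexp z) = expR (Re z).
Proof.
by rewrite /= !exprMn -mulrDr cos2Dsin2 mulr1 sqrtr_sqr ger0_norm// expR_ge0.
Qed.

Lemma cexp_neq0 z : cexp z != 0.
Proof. by rewrite -normc_gt0 normc_cexp expR_gt0. Qed.

Let expR_slope : R -> R := slope (expR : R^o -> R^o) 0.
Let cos_slope : R -> R := slope (cos : R^o -> R^o) 0.
Let sin_slope : R -> R := slope (sin : R^o -> R^o) 0.
Let Re_coef z : C :=
  (expR_slope (Re z) * cos (Im z) +i* (expR_slope (Re z) * sin (Im z)))%C.
Let Im_coef z : C := (cos_slope (Im z) +i* sin_slope (Im z))%C.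

Let cexpB1 z : cexp z - 1 = Re_coef z * (Re z)%:C%C + Im_coef z * (Im z)%:C%C.
Proof.
have expE : expR (Re z) = expR_slope (Re z) * Re z + 1.
  by have := slopeM (expR : R^o -> R^o) 0 (Re z); rewrite subr0 expR0 => ->; rewrite subrK.
have cosE : cos_slope (Im z) * Im z = cos (Im z) - 1.
  by have := slopeM (cos : R^o -> R^o) 0 (Im z); rewrite subr0 cos0.
have sinE : sin_slope (Im z) * Im z = sin (Im z).
  by have := slopeM (sin : R^o -> R^o) 0 (Im z); rewrite subr0 sin0 subr0.
by apply: eq_ReIm; rewrite /cexp expE /=; lra.
Qed.

Let continuous_slope_at0 (p : R^o -> R^o) (h : C -> R) : derivable p 0 1 ->
  continuous h -> h 0 = 0 -> {for 0, continuous (slope p 0 \o h)}.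
Proof.
move=> dp ch h0; apply: continuous_comp; first exact: ch.
by rewrite h0; exact: continuous_slope.
Qed.

Let continuous_Re_coef0 : {for 0, continuous Re_coef}.
Proof.
have continuous_expR_slope : {for 0, continuous (fun z : C => expR_slope (Re z))}.
  by apply: continuous_slope_at0 => //; exact: continuous_Re.
apply: continuous_Complex; apply: continuousM; try exact: continuous_expR_slope.
  apply: (continuous_comp (f := Im : C -> R)); first exact: continuous_Im.
  exact: continuous_cos.
apply: (continuous_comp (f := Im : C -> R)); first exact: continuous_Im.
exact: continuous_sin.
Qed.

Let continuous_Im_coef0 : {for 0, continuous Im_coef}.
Proof.
by apply: continuous_Complex; apply: continuous_slope_at0 => //; exact: continuous_Im.
Qed.

Lemma is_derive_cexp0 : is_derive (0 : C) 1 cexp 1.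
Proof.
have Re_coef0 : Re_coef 0 = 1.
  by rewrite /Re_coef /expR_slope slope_diag derive_val expR0 cos0 sin0 mulr0 mulr1.
have Im_coef0 : Im_coef 0 = 'i%C.
  by rewrite /Im_coef /cos_slope /sin_slope !slope_diag !derive_val sin0 cos0 oppr0.
apply: is_derive_normc_le => e e0; have e2 : 0 < e / 2 by rewrite divr_gt0.
have /continuous_normcP/(_ _ e2) := continuous_Re_coef0.
have /continuous_normcP/(_ _ e2) := continuous_Im_coef0.
rewrite Re_coef0 Im_coef0; apply: filterS2 => z bz az; rewrite subr0 cexp0 mul1r cexpB1.
have -> : Re_coef z * (Re z)%:C%C + Im_coef z * (Im z)%:C%C - z =
    (Re_coef z - 1) * (Re z)%:C%C + (Im_coef z - 'i%C) * (Im z)%:C%C.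
  by rewrite [X in _ - X = _]complexE; ring.
rewrite (le_trans (le_normcD _ _))// !normcM !normcR [e]splitr [leRHS]mulrDl.
by rewrite lerD// ler_pM ?normc_ge0 ?Re_le_normc ?Im_le_normc// ltW.
Qed.

Lemma is_derive_cexp z : is_derive z 1 cexp (cexp z).
Proof.
have [d0 D0] := is_derive_cexp0.
suff : is_derive z 1 cexp (cexp z * slope cexp 0 (z - z)).
  by rewrite subrr slope_diag D0 mulr1.
apply: (is_derive_of_slope (g := fun w => cexp z * slope cexp 0 (w - z))) => [w|].
  by rewrite -mulrA -{2}[w - z]subr0 slopeM mulrBr -cexpD subrKC cexp0 mulr1.
apply: (@continuousM R[i] C (cst (cexp z))); first exact: cst_continuous.
apply: (continuous_comp (f := fun w : C => w - z)).
  by apply: (@continuousB _ C C id (cst z)); [exact: cvg_id|exact: cst_continuous].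
by rewrite subrr; exact: continuous_slope.
Qed.

Lemma continuous_cexp : continuous cexp.
Proof. by move=> z; have [dexp _] := is_derive_cexp z; exact: derivable_continuous. Qed.

End ComplexExponential.

(** * The mean value property *)

Section MeanValue.
Variable R : realType.
Local Notation C := (Cplx R).
Local Notation mu := (@lebesgue_measure R).
Variables (f : C -> C) (z0 b : C).
Hypothesis f_cont : {for z0, continuous f}.
Hypothesis f_diff : forall z, z != z0 -> normc (z - z0) <= normc b -> derivable f z 1.

Let g (z : C) : C := f (z0 + b * cexp z).

Let derivable_g (z : C) : b != 0 -> Re z <= 0 -> derivable g z 1.
Proof.
move=> b0 z_le0.
have norm_b z' : normc (z0 + b * cexp z' - z0) = normc b * expR (Re z').
  by rewrite addrC addKr normcM normc_cexp.
have df : derivable f (z0 + b * cexp z) 1.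
  apply: f_diff; first by rewrite -subr_eq0 addrC addKr mulf_neq0// cexp_neq0.
  by rewrite norm_b ler_piMr ?normc_ge0// -expR0 ler_expR.
have darg := is_derive_comp (is_derive_affine z0 b (cexp z)) (is_derive_cexp z).
by have [] := is_derive_comp (g := fun w => z0 + b * cexp w) (DeriveDef df erefl) darg.
Qed.

Let continuous_g (z : C) : b != 0 -> Re z <= 0 -> {for z, continuous g}.
Proof.
by move=> b0 z_le0; exact/derivable_continuous/derivable_g.
Qed.

Let circle_integral (s : R) := \int[mu]_(t in `[0, 2 * pi]) Re (g (s +i* t)%C).

Let circle_integral_const s : b != 0 -> s <= 0 -> circle_integral 0 = circle_integral s.
Proof.
move=> b0 s0; have pi0 : 0 <= 2 * pi :> R by rewrite mulr_ge0// pi_ge0.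
(* In the variable of [g] the two circles are the vertical sides of a rectangle, whose
   horizontal sides cancel by periodicity. *)
have := @goursat R g (s, 0) (0, 2 * pi) s0 pi0.
rewrite /Im_contour_integral /=.
have -> : (fun x => Im (g (x +i* (2 * pi))%C)) = (fun x => Im (g (x +i* 0)%C)).
  by apply/funext => x; rewrite /g -(add0r (2 * pi)) cexp_periodic.
rewrite addrK => /(_ _)/eqP; rewrite subr_eq0 => /(_ _)/eqP; apply.
by move=> z [/= /andP[_ z_le0] _]; exact: derivable_g.
Qed.

Theorem mean_value_property :
  \int[mu]_(t in `[0, 2 * pi]) Re (f (z0 + b * cexp (0 +i* t)%C)) =
  Re (f z0) * (2 * pi).
Proof.
have pi0 : 0 <= 2 * pi :> R by rewrite mulr_ge0// pi_ge0.
have [b0|b0] := eqVneq b 0.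
  rewrite -[2 * pi in RHS]subr0 -Rintegral_segment_cst//.
  by apply: eq_Rintegral => t _; rewrite b0 mul0r addr0.
apply/eqP; rewrite -subr_eq0 -normr_le0.
apply: (@le0_of_le_epsM _ _ (2 * pi)) => e e0.
have /continuous_normcP/(_ _ e0)/nbhs_normcP[d d0 dP] := f_cont.
have [s s_le0 bs] : exists2 s, s <= 0 & normc b * expR s < d.
  have normb0 : 0 < normc b by rewrite normc_gt0.
  near +oo_R => x; exists (- x).
    by rewrite oppr_le0; near: x; exact: nbhs_pinfty_ge.
  rewrite mulrC -ltr_pdivlMr//; near: x.
  by apply: (cvgr_lt _ (@cvgr_expR R)); rewrite divr_gt0.
rewrite -/(circle_integral 0) (circle_integral_const b0 s_le0).
rewrite -[X in _ - _ * X]subr0 -[X in _ <= _ * X]subr0.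
apply: Rintegral_segment_close => // [|t _].
  apply: (@continuous_Re_vertical _ _ (s, s) (0, 2 * pi)); last by rewrite /= lexx.
  by move=> z [/= /andP[_ zs] _]; apply: continuous_g => //; exact: le_trans s_le0.
rewrite -ReB (le_trans (Re_le_normc _))// ltW// dP//.
by rewrite addrC addKr normcM normc_cexp.
Unshelve. all: by end_near. Qed.

Let circle_pt (t : R) : C := z0 + b * cexp (0 +i* t)%C.

Let normc_circle_pt t : normc (circle_pt t - z0) = normc b.
Proof. by rewrite addrC addKr normcM normc_cexp expR0 mulr1. Qed.

Let continuous_circle_pt t : {for t, continuous circle_pt}.
Proof.
apply: (continuous_comp (f := fun t => cexp (0 +i* t)%C) (g := fun w => z0 + b * w)).
  apply: (continuous_comp (f := fun t => (0 +i* t)%C : C)); last exact: continuous_cexp.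
  exact/continuous_Complex/cvg_id/cst_continuous.
exact: continuous_affine.
Qed.

Let continuous_Re_circle (t : R) : {for t, continuous (fun t => Re (f (circle_pt t)))}.
Proof.
apply: (continuous_comp (f := f \o circle_pt)); last exact: continuous_Re.
apply: continuous_comp; first exact: continuous_circle_pt.
have [->|ptz0] := eqVneq (circle_pt t) z0; first exact: f_cont.
by apply/derivable_continuous/f_diff => //; rewrite normc_circle_pt.
Qed.

Lemma Re_center_le m :
  (forall z, normc (z - z0) = normc b -> Re (f z) <= m) -> Re (f z0) <= m.
Proof.
move=> fm; have pi0 : 0 < 2 * pi :> R by rewrite mulr_gt0// pi_gt0.
have := @Rintegral_segment_le R (fun t => Re (f (circle_pt t))) 0 (2 * pi) m (ltW pi0).
rewrite mean_value_property subr0 ler_pM2r//; apply => [|t _].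
  by apply: continuous_subspaceT => t; exact: continuous_Re_circle.
exact/fm/normc_circle_pt.
Qed.

Lemma Re_antipode_eq_center_of_le :
  (forall z, normc (z - z0) = normc b -> Re (f z) <= Re (f z0)) ->
  Re (f (z0 - b)) = Re (f z0).
Proof.
move=> f_le; have pi0 : 0 < pi :> R by exact: pi_gt0.
pose p t := Re (f z0) - Re (f (circle_pt t)).
have p_cont (t : R) : {for t, continuous p}.
  by apply: cvgB; [exact: cvg_cst|exact: continuous_Re_circle].
have p_within : {within `[0, 2 * pi], continuous p} by exact: continuous_subspaceT.
have p_ge0 t : 0 <= p t by rewrite subr_ge0 f_le// normc_circle_pt.
have int_p0 : \int[mu]_(t in `[0, 2 * pi]) p t = 0.
  rewrite RintegralB//; last 2 first.
  - by apply/integrable_segment/continuous_subspaceT => t; exact: cvg_cst.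
  - by apply/integrable_segment/continuous_subspaceT => t; exact: continuous_Re_circle.
  by rewrite mean_value_property Rintegral_segment_cst ?subr0 ?subrr//; lra.
have piI : 0 < (pi : R) < 2 * pi by apply/andP; split => //; move: pi0; lra.
have /eqP := Rintegral_segment_eq0 p_within (fun t _ => p_ge0 t) int_p0 piI (p_cont pi).
by rewrite subr_eq0 /circle_pt cexp_pi mulrN1 => /eqP.
Qed.

End MeanValue.

Lemma Re_eq_center_of_le (R : realType) (f : Cplx R -> Cplx R) z0 (r : R) :
  {for z0, continuous f} ->
  (forall z, z != z0 -> normc (z - z0) <= r -> derivable f z 1) ->
  (forall z, normc (z - z0) = r -> Re (f z) <= Re (f z0)) ->
  forall z, normc (z - z0) = r -> Re (f z) = Re (f z0).
Proof.
move=> fc df f_le z; rewrite normcBC => zr; subst r.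
by have := Re_antipode_eq_center_of_le fc df f_le; rewrite opprB subrKC.
Qed.

(** * The maximum principle *)

Section MaximumPrinciple.
Variable R : realType.
Local Notation C := (Cplx R).
Implicit Types (q : C -> C) (K : set C) (z w : C).

Lemma continuous_normc : continuous (@normc R : C -> R).
Proof.
move=> z; apply/(@cvgrPdist_lt _ _ _ _ (nbhs_filter z)) => e e0.
apply/nbhs_normcP; exists e => // w; apply: le_lt_trans.
rewrite ler_norml lerNl opprB; apply/andP; split.
  by rewrite lerBlDr -{1}(subrK z w) le_normcD.
by rewrite lerBlDr normcBC -{1}(subrK w z) le_normcD.
Qed.

Lemma continuous_normc_sqr : continuous (fun z : C => normc z ^+ 2).
Proof.
move=> z; apply: (continuous_comp (f := @normc R : C -> R) (g := fun x => x ^+ 2)).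
  exact: continuous_normc.
exact: exprn_continuous.
Qed.

Lemma compact_rectangle (I J : R * R) : compact (rectangle I J).
Proof.
have -> : rectangle I J =
    (fun p : R * R => (p.1 +i* p.2)%C : C) @` (`[I.1, I.2] `*` `[J.1, J.2]).
  apply/seteqP; split=> [[x y] [xI yJ]|_ [p /= [pI pJ] <-]].
    by exists (x, y); rewrite //= !in_itv.
  by move: pI pJ; rewrite /= !in_itv.
apply: continuous_compact; last by apply: compact_setX; exact: segment_compact.
apply: continuous_subspaceT => p.
by apply: continuous_Complex; [exact: cvg_fst|exact: cvg_snd].
Qed.

Definition closed_disk (r : R) : set C := [set z | normc z <= r].

Lemma compact_closed_disk r : compact (closed_disk r).
Proof.
have closed_disk_closed : closed (closed_disk r).
  rewrite -[closed_disk r]/((@normc R : C -> R) @^-1` [set x | x <= r]).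
  by apply: preimage_closed; [move=> z _; exact: continuous_normc|exact: closed_le].
apply: (subclosed_compact closed_disk_closed (@compact_rectangle (- r, r) (- r, r))).
move=> z zr; rewrite /rectangle/= -!ler_norml.
by split; apply: le_trans zr; [exact: Re_le_normc|exact: Im_le_normc].
Qed.

Lemma interior_closed_disk r z : normc z < r -> (closed_disk r)° z.
Proof.
move=> zr; apply/nbhs_normcP; exists (r - normc z); first by rewrite subr_gt0.
move=> w wz; rewrite /closed_disk/= -(subrK z w) (le_trans (le_normcD _ _))//.
by rewrite -lerBrDr ltW.
Qed.

Lemma Re_add_normc_sqr_no_local_max q z (e : R) : 0 < e -> {for z, continuous q} ->
  (\forall w \near z^', derivable q w 1) ->
  ~ \forall w \near z, Re (q w) + e * normc w ^+ 2 <= Re (q z) + e * normc z ^+ 2.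
Proof.
move=> e0 qc; rewrite near_withinE => dq qmax.
have [d d_gt0 dP] := (nbhs_normcP _ _).1 (filterI dq qmax).
pose b : C := (d / 2)%:C%C.
have normb : normc b = d / 2 by rewrite normcR gtr0_norm// divr_gt0.
have b_lt w : normc (w - z) <= normc b -> normc (w - z) < d by rewrite normb; lra.
pose k : C := (2 * e)%:C%C * (z^*)%C; pose p w : C := q w + (- (k * z) + k * w).
have dp w : w != z -> normc (w - z) <= normc b -> derivable p w 1.
  move=> wz /b_lt/dP[dqw _]; apply: derivableD; first exact: dqw.
  by have [] := is_derive_affine (- (k * z)) k w.
have pc : {for z, continuous p}.
  apply: (@continuousD _ C C q (fun w : C => - (k * z) + k * w : C)); first exact: qc.
  exact: continuous_affine.
have p_le w : normc (w - z) = normc b -> Re (p w) <= Re (p z) - e * normc b ^+ 2.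
  move=> wb; have [|_] := dP w; first by apply: b_lt; rewrite wb.
  have {1}-> : normc w ^+ 2 = normc z ^+ 2 + 2 * Re ((z^*)%C * (w - z)) + normc b ^+ 2.
    by rewrite -wb -normcD_sqr subrKC.
  rewrite /p addNr addr0 ReD.
  have -> : Re (- (k * z) + k * w) = 2 * e * Re ((z^*)%C * (w - z)).
    by rewrite /k; case: (z) => x y; case: (w) => s t /=; ring.
  lra.
have := Re_center_le pc dp p_le; rewrite lerDl oppr_ge0 pmulr_rle0//.
by rewrite leNgt exprn_gt0// normb divr_gt0.
Qed.

Lemma compact_argmax (T : topologicalType) (A : set T) (h : T -> R) : A !=set0 ->
  compact A -> (forall x, A x -> {for x, continuous h}) ->
  exists2 x, A x & forall y, A y -> h y <= h x.
Proof.
move=> A0 Ac hc; have [|x /set_mem Ax hmax] := @compact_EVT_max _ R h A A0 Ac.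
  by apply: continuous_in_subspaceT => y /set_mem; exact: hc.
by exists x => // y Ay; apply: hmax; exact: mem_set.
Qed.

Theorem maximum_principle_Re q K m : compact K ->
  (forall z, K z -> {for z, continuous q}) ->
  (forall z, K° z -> \forall w \near z^', derivable q w 1) ->
  (forall z, K z -> ~ K° z -> Re (q z) <= m) ->
  forall z, K z -> Re (q z) <= m.
Proof.
move=> Kc qc dq qm z Kz; have K0 : K !=set0 by exists z.
have [far _ far_max] := compact_argmax K0 Kc (fun w _ => @continuous_normc_sqr w).
rewrite -subr_le0; apply: (@le0_of_le_epsM _ _ (normc far ^+ 2)) => e e0.
(* The perturbation by [e |z|^2] makes the real part strictly subharmonic. *)
pose F w := Re (q w) + e * normc w ^+ 2.
have [w Kw|top Ktop top_max] := compact_argmax K0 Kc (h := F).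
  apply: (@continuousD R R^o C (Re \o q)).
    by apply: continuous_comp; [exact: qc|exact: continuous_Re].
  apply: (@continuousM R C (cst e)); first exact: cst_continuous.
  exact: continuous_normc_sqr.
have [inner_top|boundary_top] := pselect (K° top).
  have := Re_add_normc_sqr_no_local_max e0 (qc _ Ktop) (dq _ inner_top).
  by case; apply: filterS inner_top => w; exact: top_max.
have F_le : F z <= F top by exact: top_max.
have top_le := qm _ Ktop boundary_top.
have : e * normc top ^+ 2 <= e * normc far ^+ 2 by rewrite ler_pM2l// far_max.
have : 0 <= e * normc z ^+ 2 by rewrite mulr_ge0 ?sqr_ge0// ltW.
move: F_le; rewrite /F; lra.
Qed.

Corollary maximum_modulus q K m : compact K -> 0 <= m ->
  (forall z, K z -> {for z, continuous q}) ->
  (forall z, K° z -> \forall w \near z^', derivable q w 1) ->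
  (forall z, K z -> ~ K° z -> normc (q z) <= m) ->
  forall z, K z -> normc (q z) <= m.
Proof.
move=> Kc m0 qc dq qm z Kz; have [->|qz0] := eqVneq (q z) 0; first by rewrite normc0.
have qz_gt0 : 0 < normc (q z) by rewrite normc_gt0.
pose g w : C := (q z)^*%C * q w.
suff : Re (g z) <= normc (q z) * m by rewrite /g mulJc /= expr2 ler_pM2l.
apply: (@maximum_principle_Re g K (normc (q z) * m) Kc _ _ _ z Kz).
- move=> w Kw; apply: (@continuousM R[i] C (cst _)); [exact: cst_continuous|exact: qc].
- by move=> w /dq; apply: filterS => x dqx; exact: derivableZ.
- move=> w Kw nK0w; apply: le_trans (ler_norm _) _; apply: le_trans (Re_le_normc _) _.
  by rewrite normcM normc_conj ler_pM2l// qm.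
Qed.

End MaximumPrinciple.

(** * Schwarz's lemma *)

Lemma le_of_lt1_mul (R : realFieldType) (a x y : R) : a < 1 -> 0 <= y ->
  (forall r, a < r < 1 -> x * r <= y) -> x <= y.
Proof.
move=> a1 y0 xy; rewrite leNgt; apply/negP => yx.
have x0 : 0 < x by exact: le_lt_trans yx.
have [max_lt1 a_le y_le] : [/\ Num.max a (y / x) < 1, a <= Num.max a (y / x)
    & y / x <= Num.max a (y / x)].
  by rewrite gt_max a1 ltr_pdivrMr ?mul1r ?yx// !le_max !lexx orbT.
pose r := (Num.max a (y / x) + 1) / 2.
have /xy : a < r < 1 by rewrite /r; lra.
rewrite leNgt => /negP; apply; rewrite mulrC -ltr_pdivrMr//; rewrite /r; lra.
Qed.

Section Schwarz.
Variable R : realType.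
Local Notation C := (Cplx R).
Implicit Types z w : C.

Lemma eq_of_Re_mulJ z w : normc w <= normc z -> normc z ^+ 2 <= Re ((z^*)%C * w) -> w = z.
Proof.
move=> wz zw; apply/eqP; rewrite -subr_eq0 -normc_eq0 -sqrf_eq0 eq_le sqr_ge0 andbT.
have sqr_wz : normc w ^+ 2 <= normc z ^+ 2 by rewrite ler_pXn2r ?nnegrE ?normc_ge0.
have -> : w - z = - z + w by rewrite addrC.
rewrite normcD_sqr normcN; suff -> : Re ((- z)^*%C * w) = - Re ((z^*)%C * w) by lra.
by rewrite rmorphN mulNr ReN.
Qed.

Variables (g : C -> C) (m : R).
Hypothesis dg : forall z, normc z < 1 -> derivable g z 1.
Hypothesis g0 : g 0 = 0.
Hypothesis g_le : forall z, normc z < 1 -> normc (g z) <= m.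

Let slopeM0 z : slope g 0 z * z = g z.
Proof. by have := slopeM g 0 z; rewrite g0 !subr0. Qed.

Let continuous_slope0 z : normc z < 1 -> {for z, continuous (slope g 0)}.
Proof.
move=> z1; have [->|z0] := eqVneq z 0.
  by apply: continuous_slope; apply: dg; rewrite normc0.
exact/derivable_continuous/derivable_slope/dg.
Qed.

Let near_derivable_slope0 z : normc z < 1 ->
  \forall w \near z^', derivable (slope g 0) w 1.
Proof.
move=> z1; rewrite near_withinE.
have near_neq0 : \forall w \near z, w != z -> w != 0.
  have [->|z0] := eqVneq z 0; first by apply/nbhs_normcP; exists 1.
  apply/nbhs_normcP; exists (normc z) => [|w wz _]; first by rewrite normc_gt0.
  by apply: contraTneq wz => ->; rewrite sub0r normcN ltxx.
near=> w => wz; apply: derivable_slope; first exact: (near near_neq0 w).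
by apply: dg; near: w; exact: cvgr_lt (@continuous_normc R z) _ z1.
Unshelve. all: by end_near. Qed.

Lemma schwarz_slope z : normc z < 1 -> normc (slope g 0 z) <= m.
Proof.
have m0 : 0 <= m by apply: le_trans (normc_ge0 (g 0)) (g_le _); rewrite normc0.
move=> z1; apply: (le_of_lt1_mul z1 m0) => r /andP[zr r1].
have r0 : 0 < r by exact: le_lt_trans (normc_ge0 z) zr.
rewrite -ler_pdivlMr//.
apply: (maximum_modulus (K := closed_disk r)); last exact: ltW.
- exact: compact_closed_disk.
- by rewrite divr_ge0// ltW.
- by move=> w wr; apply: continuous_slope0; exact: le_lt_trans r1.
- move=> w /interior_subset wr; apply: near_derivable_slope0; exact: le_lt_trans r1.
- move=> w wr nwr; have wE : normc w = r.
    by apply/eqP; rewrite eq_le wr leNgt; apply/negP => /interior_closed_disk.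
  by rewrite ler_pdivlMr// -{1}wE -normcM slopeM0 g_le// wE.
Qed.

Theorem schwarz z : normc z < 1 -> normc (g z) <= m * normc z.
Proof. by move=> z1; rewrite -slopeM0 normcM ler_wpM2r ?normc_ge0// schwarz_slope. Qed.

Theorem schwarz_derive0 : normc ('D_1 g 0) <= m.
Proof. by rewrite -slope_diag schwarz_slope// normc0. Qed.

Theorem schwarz_rigidity : normc ('D_1 g 0) = m ->
  forall z, normc z < 1 -> g z = 'D_1 g 0 * z.
Proof.
rewrite -slope_diag => gm z z1; rewrite -slopeM0; congr (_ * _).
apply: eq_of_Re_mulJ; first by rewrite gm schwarz_slope.
pose q w : C := (slope g 0 0)^*%C * slope g 0 w.
have D0 : normc (0 : C) < 1 by rewrite normc0.
have qc : {for 0, continuous q}.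
  by apply: (@continuousM R[i] C (cst _)); [exact: cst_continuous|exact: continuous_slope0].
have dq w : w != 0 -> normc (w - 0) <= normc z -> derivable q w 1.
  rewrite subr0 => w0 wz; apply: derivableZ.
  by apply: (derivable_slope w0); apply: dg; exact: le_lt_trans z1.
have q_max w : normc (w - 0) = normc z -> Re (q w) <= Re (q 0).
  rewrite subr0 => wz; rewrite {2}/q mulJc /=.
  apply: le_trans (ler_norm _) _; apply: le_trans (Re_le_normc _) _.
  by rewrite normcM normc_conj expr2 ler_wpM2l ?normc_ge0// gm schwarz_slope// wz.
have := Re_eq_center_of_le qc dq q_max (z := z); rewrite subr0 => /(_ erefl).
by rewrite /q mulJc /= => ->.
Qed.

End Schwarz.

(** * Functions with real derivative *)

Section RealDerivative.
Variable R : realType.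
Local Notation C := (Cplx R).
Implicit Types (f : C -> C) (a b c k v w z : C) (s t : R) (D : set C).

Lemma continuous_line z v : continuous (fun s => z + v * s%:C%C).
Proof.
move=> s; apply: (continuous_comp (f := fun s => s%:C%C : C) (g := fun w => z + v * w)).
  exact/continuous_Complex/cst_continuous/cvg_id.
exact: continuous_affine.
Qed.

(* Every real-linear functional on the plane is of the form [z |-> Re (k z)]. *)
Lemma is_derive_Re_line f k z v t a : is_derive (z + v * t%:C%C) 1 f a ->
  is_derive t 1 (fun s => Re (k * f (z + v * s%:C%C))) (Re (k * v * a)).
Proof.
set z1 := z + _ => -[df <-]; apply/is_derive1_caratheodory.
exists (fun s => Re (k * v * slope f z1 (z + v * s%:C%C))); split=> [s||].
- rewrite -ReB -mulrBr -slopeM.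
  have -> : z + v * s%:C%C - z1 = v * (s - t)%:C%C by rewrite /z1 rmorphB; ring.
  have -> : k * (slope f z1 (z + v * s%:C%C) * (v * (s - t)%:C%C)) =
      k * v * slope f z1 (z + v * s%:C%C) * (s - t)%:C%C by ring.
  by case: (k * v * _) => x y /=; ring.
- apply: (continuous_comp (f := fun s => k * v * slope f z1 (z + v * s%:C%C))); last first.
    exact: continuous_Re.
  apply: (continuous_comp (f := fun s => slope f z1 (z + v * s%:C%C)) (g := *%R (k * v))).
    apply: (continuous_comp (g := slope f z1)); first exact: continuous_line.
    exact: continuous_slope.
  exact: mulrl_continuous.
- by rewrite slope_diag.
Qed.

Lemma Re_segment_eq f f' k a b :
  (forall t, 0 <= t <= 1 -> let z := a + (b - a) * t%:C%C in
    is_derive z 1 f (f' z) /\ Re (k * (b - a) * f' z) = 0) ->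
  Re (k * f b) = Re (k * f a).
Proof.
move=> df; pose p t := Re (k * f (a + (b - a) * t%:C%C)).
have dp t : 0 <= t <= 1 -> is_derive t 1 p 0.
  by move=> /df[dfz <-]; exact: is_derive_Re_line.
have [||t _] := @MVT R p (fun=> 0) 0 1 ltr01.
- by move=> t; rewrite in_itv/= => /andP[? ?]; apply: dp; lra.
- apply: derivable_within_continuous => t; rewrite in_itv/= => tI.
  by have [] := dp t tI.
by rewrite mul0r /p mulr1 mulr0 addr0 subrKC => /eqP; rewrite subr_eq0 => /eqP.
Qed.

Lemma Re_derive_near_eq f k v z w a b : is_derive z 1 f a -> is_derive w 1 f b ->
  (\forall s \near (0 : R), Re (k * f (z + v * s%:C%C)) = Re (k * f (w + v * s%:C%C))) ->
  Re (k * v * a) = Re (k * v * b).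
Proof.
move=> dfz dfw fE; have := near_eq_derive (1 : R^o) fE.
have derive_line (x d : C) : is_derive x 1 f d ->
    'D_1 (fun s => Re (k * f (x + v * s%:C%C))) 0 = Re (k * v * d).
  by move=> dfx; have := @is_derive_Re_line f k x v 0 d; rewrite mulr0 addr0 => /(_ dfx)[].
by rewrite (derive_line z a dfz) (derive_line w b dfw).
Qed.

Definition convex_domain D := open D /\
  forall a b t, D a -> D b -> 0 <= t <= 1 -> D (a + (b - a) * t%:C%C).

Lemma unit_disk_convex_domain : convex_domain (unit_disk R).
Proof.
split=> [|a b t].
  have -> : unit_disk R = (@normc R : C -> R) @^-1` [set x | x < 1].
    by apply/seteqP; split=> z; rewrite /unit_disk/= norm_normc ltcR.
  by apply: open_comp; [move=> z _; exact: continuous_normc|exact: open_lt].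
rewrite /unit_disk/= !norm_normc !ltcR => a1 b1 /andP[t0 t1].
have -> : a + (b - a) * t%:C%C = a * (1 - t)%:C%C + b * t%:C%C by rewrite rmorphB; ring.
apply: le_lt_trans (le_normcD _ _) _; rewrite !normcM !normcR !ger0_norm ?subr_ge0//.
by have [t_lt1|] := ltP t 1; nra.
Qed.

Lemma near_line D z v : open D -> D z -> \forall s \near (0 : R), D (z + v * s%:C%C).
Proof.
move=> oD Dz; apply: (@continuous_line z v 0); apply: open_nbhs_nbhs.
by rewrite mulr0 addr0.
Qed.

Lemma real_derive_const D f f' : convex_domain D ->
  (forall z, D z -> is_derive z 1 f (f' z)) -> (forall z, D z -> Im (f' z) = 0) ->
  forall z w, D z -> D w -> f' z = f' w.
Proof.
move=> [oD cD] df f'_real z w Dz Dw; have [->//|zw] := eqVneq z w.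
have Re_k_const k a b : D a -> D b -> Re (k * (b - a)) = 0 ->
    Re (k * f b) = Re (k * f a).
  move=> Da Db kab; apply: (@Re_segment_eq f f') => t tI; split; first exact/df/cD.
  have := f'_real _ (cD a b t Da Db tI); move: kab.
  by case: (k * _) => u v; case: (f' _) => x y /= -> ->; ring.
(* This [k] turns [z - w] into the imaginary axis. *)
pose k := 'i%C * (z - w)^*%C.
have k0 : k != 0.
  by rewrite mulf_neq0 ?complexiE ?neq0Ci// -normc_eq0 normc_conj normc_eq0 subr_eq0.
have kzw : Re (k * (z - w)) = 0 by rewrite /k -mulrA mulJc /=; ring.
apply: eq_ReIm; last by rewrite !f'_real.
have := @Re_derive_near_eq f k k^-1 z w _ _ (df z Dz) (df w Dw).
rewrite divff// !mul1r; apply.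
have near_z := near_line k^-1 oD Dz; have near_w := near_line k^-1 oD Dw.
apply: filterS2 near_z near_w => s Dzs Dws; apply: Re_k_const => //.
by rewrite opprD addrACA subrr addr0.
Qed.

Lemma affine_of_derive_const D f c : convex_domain D ->
  (forall z, D z -> is_derive z 1 f c) ->
  forall z w, D z -> D w -> f z = f w + c * (z - w).
Proof.
move=> [_ cD] df z w Dz Dw; pose g x := f x + (- (c * w) + - c * x).
have dg (x : C) : D x -> is_derive x 1 g 0.
  by move=> Dx; rewrite -(subrr c); exact: is_deriveD (df x Dx) (is_derive_affine _ _ x).
have Re_g k : Re (k * g z) = Re (k * g w).
  apply: (@Re_segment_eq g (cst 0)) => t tI x.
  by split; [exact/dg/cD|rewrite mulr0].
have g_eq : g z = g w.
  have := Re_g 1; have := Re_g (- 'i%C).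
  by case: (g z) => ? ?; case: (g w) => ? ? /= gim gre; apply: eq_ReIm => /=; lra.
have fE x : f x = g x + c * w + c * x by rewrite /g; ring.
by rewrite (fE z) (fE w) g_eq; ring.
Qed.

End RealDerivative.

(** * The diameter version of Schwarz's lemma *)

Section LandauToeplitz.
Variable R : realType.
Local Notation C := (Cplx R).
Variables (f : C -> C) (m : R).
Hypothesis df : forall z : C, normc z < 1 -> derivable f z 1.
Hypothesis f_diam : forall z w : C, normc z < 1 -> normc w < 1 ->
  normc (f z - f w) <= 2 * m.
Local Notation c := ('D_1 f 0).

Definition rotation_diff (w z : C) : C := f z - f (w * z).

Let normc_mul_lt1 (w z : C) : normc w <= 1 -> normc z < 1 -> normc (w * z) < 1.
Proof. by move=> w1; apply: le_lt_trans; rewrite normcM ler_piMl ?normc_ge0. Qed.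

Let is_derive_rotation_diff (w z : C) : normc w <= 1 -> normc z < 1 ->
  is_derive z 1 (rotation_diff w) ('D_1 f z - 'D_1 f (w * z) * w).
Proof.
move=> w1 z1; apply: is_deriveB; first exact/DeriveDef/erefl/df.
have dfwz := df (normc_mul_lt1 w1 z1).
exact: (is_derive_comp (g := *%R w) (DeriveDef dfwz erefl) (is_derive_mull w z)).
Qed.

Let rotation_diff_le (w : C) : normc w <= 1 ->
  forall z, normc z < 1 -> normc (rotation_diff w z) <= 2 * m.
Proof. by move=> w1 z z1; apply: f_diam => //; exact: normc_mul_lt1. Qed.

Let derivable_rotation_diff (w : C) : normc w <= 1 ->
  forall z, normc z < 1 -> derivable (rotation_diff w) z 1.
Proof. by move=> w1 z z1; have [] := is_derive_rotation_diff w1 z1. Qed.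

Let rotation_diff0 w : rotation_diff w 0 = 0.
Proof. by rewrite /rotation_diff mulr0 subrr. Qed.

Let normcN1 : normc (-1 : C) = 1. Proof. by rewrite normcN normc1. Qed.
Let normcN1_le1 : normc (-1 : C) <= 1. Proof. by rewrite normcN1. Qed.

Lemma dist_le_max_norm (z w : C) : normc w <= normc z -> normc z < 1 ->
  normc (f z - f w) <= 2 * m * normc z.
Proof.
move=> wz z1; have [z0|z0] := eqVneq z 0.
  have w0 : w = 0.
    by apply/eqP; rewrite -normc_eq0 eq_le normc_ge0 andbT -[leRHS](normc0 R) -z0.
  by rewrite z0 w0 subrr normc0 mulr0.
have wz1 : normc (w / z) <= 1 by rewrite normcM normcV ler_pdivrMr ?mul1r// normc_gt0.
have := schwarz (derivable_rotation_diff wz1) (rotation_diff0 _) (rotation_diff_le wz1) z1.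
by rewrite /rotation_diff divfK.
Qed.

Let derive_rotation_diffN1 : 'D_1 (rotation_diff (-1)) 0 = 2 * c.
Proof.
have z1 : normc (0 : C) < 1 by rewrite normc0.
by have [_ ->] := is_derive_rotation_diff normcN1_le1 z1; rewrite mulr0; ring.
Qed.

Theorem derive0_le_half_diam : normc c <= m.
Proof.
have := schwarz_derive0 (derivable_rotation_diff normcN1_le1) (rotation_diff0 _)
  (rotation_diff_le normcN1_le1).
by rewrite derive_rotation_diffN1 normcM normc_nat ler_pM2l.
Qed.

Hypothesis derive0_norm : normc c = m.

Lemma extremal_odd_part (z : C) : normc z < 1 -> f z - f (- z) = 2 * c * z.
Proof.
move=> z1.
have := schwarz_rigidity (derivable_rotation_diff normcN1_le1) (rotation_diff0 _)
  (rotation_diff_le normcN1_le1).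
rewrite derive_rotation_diffN1 normcM normc_nat derive0_norm => /(_ erefl z z1).
by rewrite /rotation_diff mulN1r.
Qed.

Let circle_path (z : C) (t : R) : C := z * cexp (0 + 'i%C * t%:C%C).

Let normc_circle_path z t : normc (circle_path z t) = normc z.
Proof. by rewrite normcM normc_cexp /= !mul0r mul1r oppr0 !add0r expR0 mulr1. Qed.

Let circle_path0 z : circle_path z 0 = z.
Proof. by rewrite /circle_path mulr0 addr0 cexp0 mulr1. Qed.

Lemma extremal_Re_max (z u : C) : normc z < 1 -> normc u = normc z ->
  Re ((c * z)^*%C * f u) <= Re ((c * z)^*%C * f z).
Proof.
move=> z1 uz; have u1 : normc u < 1 by rewrite uz.
rewrite -(lerD2r (- Re ((c * z)^*%C * f (- z)))) -!ReB -!mulrBr extremal_odd_part//.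
have -> : Re ((c * z)^*%C * (2 * c * z)) = 2 * m * normc z * normc (c * z).
  have -> : (c * z)^*%C * (2 * c * z) = (normc (c * z) ^+ 2)%:C%C *+ 2.
    by rewrite -mulJc; ring.
  by rewrite -rmorphMn /= normcM derive0_norm; ring.
apply: le_trans (ler_norm _) _; apply: le_trans (Re_le_normc _) _.
rewrite normcM normc_conj mulrC ler_wpM2r ?normc_ge0// -uz.
by apply: dist_le_max_norm => //; rewrite normcN uz.
Qed.

Lemma extremal_derive_real (z : C) : normc z < 1 -> Im (c^*%C * 'D_1 f z) = 0.
Proof.
move=> z1; have [->|z0] := eqVneq z 0; first by rewrite mulJc.
pose g (w : C) : C := f (z * cexp w).
have dg (t : R) : is_derive (0 + 'i%C * t%:C%C : C) 1 g
    ('D_1 f (circle_path z t) * circle_path z t).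
  have df_path : derivable f (circle_path z t) 1 by apply: df; rewrite normc_circle_path.
  apply: (is_derive_comp (g := fun w => z * cexp w) (DeriveDef df_path erefl)).
  exact: is_derive_comp (is_derive_mull z _) (is_derive_cexp _).
pose p (t : R) := Re ((c * z)^*%C * g (0 + 'i%C * t%:C%C)).
have dp (t : R) := is_derive_Re_line ((c * z)^*%C) (dg t); rewrite -/p in dp.
have [_ p'0] : is_derive (0 : R) 1 p 0.
  apply: (@derive1_at_max _ p (-1) 1) => [|t _||t _].
  - lra.
  - by have [] := dp t.
  - by rewrite in_itv/=; lra.
  - rewrite /p /g -!/(circle_path z _) circle_path0.
    by apply: extremal_Re_max => //; rewrite normc_circle_path.
have [_] := dp 0; rewrite p'0 circle_path0.
have -> : (c * z)^*%C * 'i%C * ('D_1 f z * z) =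
    'i%C * ((normc z ^+ 2)%:C%C * (c^*%C * 'D_1 f z)).
  by rewrite -mulJc rmorphM; ring.
case: (c^*%C * _) => x y /= /eqP.
have -> : 0 * (normc z ^+ 2 * x - 0 * y) - 1 * (normc z ^+ 2 * y + 0 * x) =
    - (normc z ^+ 2 * y) by ring.
by rewrite eq_sym oppr_eq0 mulf_eq0 sqrf_eq0 normc_eq0 (negbTE z0) => /eqP.
Qed.

Theorem extremal_affine z : normc z < 1 -> f z = f 0 + c * z.
Proof.
move=> z1; have D0 : normc (0 : C) < 1 by rewrite normc0.
have [c0|c_neq0] := eqVneq c 0.
  have := f_diam z1 D0; rewrite -derive0_norm c0 normc0 mulr0 mul0r addr0.
  by rewrite le_eqVlt ltNge normc_ge0 orbF normc_eq0 subr_eq0 => /eqP.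
have diskE (w : C) : unit_disk R w <-> normc w < 1 by rewrite -mem_unit_disk inE.
have dJf (w : C) : unit_disk R w ->
    is_derive w 1 ( *%R c^*%C \o f : C -> C) (c^*%C * 'D_1 f w).
  by move=> /diskE/df dfw; exact: is_derive_comp (is_derive_mull _ _) (DeriveDef dfw erefl).
have Jf'_real (w : C) : unit_disk R w -> Im (c^*%C * 'D_1 f w) = 0.
  by move=> /diskE; exact: extremal_derive_real.
have df_c (w : C) : unit_disk R w -> is_derive w 1 f c.
  move=> Dw; apply: DeriveDef; first exact/df/diskE.
  have Jc0 : c^*%C != 0 by rewrite conjc_eq0.
  apply: (mulfI Jc0); apply: (real_derive_const (unit_disk_convex_domain R) dJf) => //.
  exact/diskE.
have := affine_of_derive_const (unit_disk_convex_domain R) df_c (z := z) (w := 0).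
by rewrite subr0; apply; exact/diskE.
Qed.

End LandauToeplitz.

Theorem theorem2 (R : realType) (f : Cplx R -> Cplx R) :
  analytic_on_disk f ->
  Diam_le (f @` unit_disk R) 2 ->
  `|'D_1 f 0| <= 1 /\
  (`|'D_1 f 0| = 1 <->
     exists a c : Cplx R, `|c| = 1 /\
       (forall z : Cplx R, z \in unit_disk R -> f z = a + c * z)).
Proof.
move=> f_analytic f_diam.
have df (z : Cplx R) : normc z < 1 -> derivable f z 1.
  by rewrite -mem_unit_disk; exact: f_analytic.
have f_dist (z w : Cplx R) : normc z < 1 -> normc w < 1 ->
    normc (f z - f w) <= 2 * 1.
  rewrite -!mem_unit_disk !inE => zD wD.
  have := f_diam _ _ (imageP f zD) (imageP f wD).
  by rewrite mulr1 norm_normc -[2]/(2%:R) -(rmorph_nat (real_complex R)) lecR.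
have norm1P (z : Cplx R) : `|z| = 1 <-> normc z = 1.
  by rewrite norm_normc; split=> [/complexI|->].
split; first by rewrite norm_normc lecR; exact: derive0_le_half_diam.
split=> [/norm1P f'1|[a [b [b_norm f_affine]]]].
  exists (f 0), ('D_1 f 0); split; first exact/norm1P.
  by move=> z; rewrite mem_unit_disk; exact: extremal_affine df f_dist f'1 z.
have f_near : \forall z \near (0 : Cplx R), f z = a + b * z.
  apply/nbhs_normcP; exists 1 => // z.
  by rewrite subr0 -mem_unit_disk; exact: f_affine.
by rewrite (near_eq_derive (1 : Cplx R) f_near); have [_ ->] := is_derive_affine a b 0.
Qed.
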